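(* For $n \in \mathbb{N}$ let $U_n = \sum_{q=1}^{n} q$ (with $U_0 = 0$), and define $$Y_n = U_n - 4\,U_{\lfloor n/2 \rfloor},$$ where $\lfloor r \rfloor$ denotes the greatest integer less than or equal to $r$. Define the Cesàro means $$Z_N = \frac{1}{N}\sum_{n=1}^{N} Y_n \quad (N \ge 1), \qquad X_M = \frac{1}{M}\sum_{N=1}^{M} Z_N \quad (M \ge 1).$$ Then for every positive integer $K$ the following hold. $$X_{2K} = \frac14 + \frac{1}{8K}\sum_{j=1}^{K}\frac{1}{j-1/2}, \qquad X_{2K+1} = \frac{K+1}{4K+2} + \frac{1}{8K+4}\sum_{j=1}^{K+1}\frac{1}{j-1/2},$$ $$\left|X_{2K} - \frac14\right| \le \frac{1}{3K} + \frac{\log(K+1)}{8K}, \qquad \left|X_{2K+1} - \frac14\right| \le \frac{16/3 + \log(K+1)}{8K+4}.$$ Consequently $\lim_{M\to\infty} X_M = \frac14$. Equivalently, $$\lim_{M\to\infty} \frac{1}{M}\sum_{N=1}^{M}\left(\frac{1}{N}\sum_{n=1}^{N} \frac{U_n - 4U_{\lfloor n/2\rfloor}}{1-4}\right) = -\frac{1}{12}.$$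
   Context: $\log$ denotes the natural logarithm. *)

(* Defs.v *)
From mathcomp Require Import all_boot all_order all_algebra.
From mathcomp Require Import all_classical all_reals all_analysis.

Set Implicit Arguments.
Unset Strict Implicit.
Unset Printing Implicit Defensive.

Import Order.TTheory GRing.Theory Num.Theory.
Import numFieldNormedType.Exports.

Local Open Scope ring_scope.

Definition U (n : nat) : nat := (\sum_(1 <= q < n.+1) q)%N.

Definition Y (R : realType) (n : nat) : R :=
  (U n)%:R - 4 * (U (n %/ 2))%:R.

(* Sequences are averaged from index 1 on. The value at N = 0 is a junk 0. *)
Definition cesaro (R : realType) (u : nat -> R) (N : nat) : R :=
  1 / N%:R * \sum_(1 <= n < N.+1) u n.

Definition Z (R : realType) : nat -> R := cesaro (@Y R).

Definition X (R : realType) : nat -> R := cesaro (@Z R).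

(* Main.v *)
(* Pairing terms gives Y_{2m} = -m and Y_{2m+1} = m + 1, so the partial sums of Y
   are 0 at even and m + 1 at odd indices; hence Z_{2m} = 0 and
   Z_{2m+1} = (m + 1) / (2m + 1) = 1/2 + (1/4) / (m + 1/2). Averaging once more
   gives the closed forms of X. The remaining sum is bounded by keeping its first
   two terms, 2 + 2/3 = 8/3, and comparing the others with
   1 / x <= ln x - ln (x - 1). *)
Require Import Defs.
From mathcomp Require Import all_boot all_order all_algebra.
From mathcomp Require Import all_classical all_reals all_analysis.
From mathcomp Require Import ring lra zify.

Set Implicit Arguments.
Unset Strict Implicit.
Unset Printing Implicit Defensive.

Import Order.TTheory GRing.Theory Num.Theory.
Import numFieldNormedType.Exports.

Local Open Scope classical_set_scope.
Local Open Scope ring_scope.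

Lemma U_double n : (2 * U n = n * n.+1)%N.
Proof.
rewrite /U; elim: n => [|n IHn]; first by rewrite big_geq.
by rewrite big_nat_recr //= mulnDr IHn; lia.
Qed.

Lemma U_closed (R : realType) n : (U n)%:R = n%:R * (n%:R + 1) / 2 :> R.
Proof.
have /(congr1 (GRing.natmul (1 : R))) := U_double n.
by rewrite !natrM -[n.+1%:R]natr1 => <-; field.
Qed.

Lemma Y_even (R : realType) m : Y R (2 * m) = - m%:R.
Proof. by rewrite /Y mulKn // !U_closed natrM; field. Qed.

Lemma Y_odd (R : realType) m : Y R (2 * m).+1 = m%:R + 1.
Proof.
rewrite /Y; have -> : ((2 * m).+1 %/ 2 = m)%N by lia.
by rewrite !U_closed -natr1 natrM; field.
Qed.

Lemma sum_Y_even (R : realType) m : \sum_(1 <= n < (2 * m).+1) Y R n = 0.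
Proof.
elim: m => [|m IHm]; first by rewrite big_geq.
rewrite mulnS add2n 2?big_nat_recr //= IHm Y_odd.
have -> : (2 * m).+2 = (2 * m.+1)%N by lia.
by rewrite Y_even -natr1; ring.
Qed.

Lemma Z_even (R : realType) m : Z R (2 * m) = 0.
Proof. by rewrite /Z /Defs.cesaro sum_Y_even mulr0. Qed.

(** The denominator is written with [m.+1] so that the last factor is the term [j = m.+1] of the
    sums in the closed forms of [X]. *)
Lemma Z_odd (R : realType) m :
  Z R (2 * m).+1 = 1 / 2 + 1 / 4 * (1 / (m.+1%:R - 1 / 2)).
Proof.
rewrite /Z /Defs.cesaro big_nat_recr //= sum_Y_even Y_odd -!natr1 natrM.
have m0 : 0 <= m%:R :> R := ler0n _ _.
by field; lra.
Qed.

Lemma sum_Z_even (R : realType) K :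
  \sum_(1 <= n < (2 * K).+1) Z R n
    = K%:R / 2 + 1 / 4 * \sum_(1 <= j < K.+1) 1 / (j%:R - 1 / 2).
Proof.
elim: K => [|K IHK]; first by rewrite !big_geq // mul0r mulr0 addr0.
rewrite mulnS add2n 2?big_nat_recr //= IHK Z_odd.
have -> : (2 * K).+2 = (2 * K.+1)%N by lia.
by rewrite Z_even [in RHS]big_nat_recr //= -!natr1; ring.
Qed.

Lemma X_even (R : realType) K : (0 < K)%N ->
  X R (2 * K) = 1 / 4 + 1 / (8 * K%:R) * \sum_(1 <= j < K.+1) 1 / (j%:R - 1 / 2).
Proof.
move=> K0; rewrite /X /Defs.cesaro sum_Z_even natrM.
have : K%:R != 0 :> R by rewrite pnatr_eq0 -lt0n.
by move=> ?; field.
Qed.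

Lemma X_odd (R : realType) K :
  X R (2 * K + 1) = (K%:R + 1) / (4 * K%:R + 2)
    + 1 / (8 * K%:R + 4) * \sum_(1 <= j < K.+2) 1 / (j%:R - 1 / 2).
Proof.
rewrite addn1 /X /Defs.cesaro big_nat_recr //= sum_Z_even Z_odd.
rewrite [in RHS]big_nat_recr //= -!natr1 natrM.
have K0 : 0 <= K%:R :> R := ler0n _ _.
by field; do ?[apply/andP; split]; lra.
Qed.

(** Since [x - 1 = x * (1 - x^-1)], this is [ln (1 + t) <= t] at [t = - x^-1], where [x > 1] keeps
    [t] above [-1]. *)
Lemma inv_le_ln_step (R : realType) (x : R) :
  1 < x -> x^-1 <= ln x - ln (x - 1).
Proof.
move=> x1; have x0 : 0 < x by lra.
have xV1 : x^-1 < 1 by rewrite invf_lt1.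
have -> : x - 1 = x * (1 + - x^-1) by field; lra.
rewrite lnM ?posrE //; last by lra.
have := @le_ln1Dx R (- x^-1); lra.
Qed.

Lemma sum_inv_half_le (R : realType) K :
  \sum_(1 <= j < K.+2) 1 / (j%:R - 1 / 2) <= 8 / 3 + ln (K%:R + 1) :> R.
Proof.
have h1 : 1 / (1%:R - 1 / 2) = 2 :> R by field.
have h2 : 1 / (2%:R - 1 / 2) = 2 / 3 :> R by field.
case: K => [|K]; first by rewrite big_nat1 add0r ln1 h1; lra.
(* With [K.+2] terms, the induction proves the sharper [ln K.+1]: the terms from [j = 3] on are at
   most [ln (j - 1) - ln (j - 2)], which telescopes down to [ln 1 = 0]. *)
apply: (@le_trans _ _ (8 / 3 + ln K.+1%:R)); last first.
  by rewrite lerD2l ler_ln ?posrE ?ltr0n // lerDl.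
elim: K => [|K IHK]; first by rewrite 2?big_nat_recr // big_geq //= ln1 h1 h2; lra.
rewrite big_nat_recr //=.
have K0 : 0 < K.+1%:R :> R by rewrite ltr0n.
have := @inv_le_ln_step R K.+2%:R; rewrite -[K.+3%:R]natr1 -[K.+2%:R]natr1.
rewrite addrK => step.
(* The new term has [j = K.+3]; lowering [j - 1 / 2] to [j - 1] lets [step] apply at [x = K.+2]. *)
have : 1 / (K.+1%:R + 1 + 1 - 1 / 2) <= (K.+1%:R + 1)^-1 :> R.
  by rewrite div1r lef_pV2 ?posrE; lra.
have := step ltac:(lra); lra.
Qed.

Lemma sum_inv_half_ge0 (R : realType) K :
  0 <= \sum_(1 <= j < K) 1 / (j%:R - 1 / 2) :> R.
Proof.
rewrite big_nat sumr_ge0 // => j /andP[j1 _].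
by rewrite divr_ge0 // subr_ge0; have := j1; rewrite -(ler_nat R); lra.
Qed.

Lemma X_even_dist (R : realType) K : (0 < K)%N ->
  `|X R (2 * K) - 1 / 4| <= 1 / (3 * K%:R) + ln (K%:R + 1) / (8 * K%:R).
Proof.
case: K => // K _; rewrite X_even // addrAC subrr add0r.
have K0 : 0 < K.+1%:R :> R by rewrite ltr0n.
rewrite ger0_norm; last by rewrite mulr_ge0 ?sum_inv_half_ge0 ?divr_ge0 //; lra.
have -> : 1 / (3 * K.+1%:R) + ln (K.+1%:R + 1) / (8 * K.+1%:R)
    = 1 / (8 * K.+1%:R) * (8 / 3 + ln (K.+1%:R + 1)) :> R by field; lra.
rewrite ler_pM2l; last by rewrite divr_gt0 //; lra.
(* After the case split the sum has [K.+1] terms, so it is bounded with [ln (K + 1)], below the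
   [ln (K + 2)] of the goal. *)
apply: le_trans (sum_inv_half_le R K) _; rewrite lerD2l.
have := ler0n R K; rewrite -natr1 in K0 * => K0'.
by rewrite ler_ln ?posrE; lra.
Qed.

Lemma X_odd_dist (R : realType) K :
  `|X R (2 * K + 1) - 1 / 4| <= (16 / 3 + ln (K%:R + 1)) / (8 * K%:R + 4).
Proof.
rewrite X_odd; have K0 : 0 <= K%:R :> R := ler0n _ _.
set S := \sum_(_ <= _ < _) _.
have S0 : 0 <= S := sum_inv_half_ge0 _ _.
have Sle : S <= _ := sum_inv_half_le R K.
(* The leading fraction exceeds [1 / 4] by exactly [1 / (8 * K + 4)]. The resulting constant
   [1 + 8 / 3 = 11 / 3] is below [16 / 3]. *)
have -> : (K%:R + 1) / (4 * K%:R + 2) + 1 / (8 * K%:R + 4) * S - 1 / 4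
    = (1 + S) / (8 * K%:R + 4) by field; do ?[apply/andP; split]; lra.
rewrite ger0_norm; last by rewrite divr_ge0 //; lra.
rewrite ler_pM2r; first by lra.
by rewrite invr_gt0; lra.
Qed.

(** A single rate for both parities, free of logarithms, from which the limit follows with an
    explicit threshold. *)
Lemma X_dist (R : realType) M : (0 < M)%N ->
  `|X R M - 1 / 4| <= 2 / Num.sqrt M%:R.
Proof.
move=> M0; have M1 : 1 <= M%:R :> R by rewrite ler1n.
set s := Num.sqrt _.
have ss : s * s = M%:R by rewrite -expr2 sqr_sqrtr //; lra.
have s1 : 1 <= s by rewrite -sqrtr1 ler_sqrt //; lra.
(* [ln M = 2 * ln s], and [ln s <= s - 1]. *)
have lnM_le : ln M%:R <= 2 * (s - 1).
  rewrite -ss lnM ?posrE; [|lra|lra].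
  by have := @le_ln1Dx R (s - 1); rewrite addrCA subrr addr0; lra.
(* Both parities fit this bound: [8 * K] and [8 * K + 4] are each [4 * M], and [K + 1 <= M] in
   either case. *)
have half : `|X R M - 1 / 4| <= (16 / 3 + ln M%:R) / (4 * M%:R).
  have [K [[K0 EM]|EM]] : exists K, (0 < K)%N /\ M = (2 * K)%N \/ M = (2 * K + 1)%N.
  - by exists (M %/ 2)%N; lia.
  - have K1 : 1 <= K%:R :> R by rewrite ler1n.
    have lnle : ln (K%:R + 1) <= ln M%:R :> R.
      by rewrite ler_ln ?posrE ?EM ?natrM; lra.
    rewrite EM; apply: le_trans (X_even_dist R K0) _; rewrite -EM.
    have -> : 1 / (3 * K%:R) + ln (K%:R + 1) / (8 * K%:R)
      = (8 / 3 + ln (K%:R + 1)) / (4 * M%:R) :> R by rewrite EM natrM; field; lra.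
    by rewrite ler_pM2r ?invr_gt0; lra.
  - have K0 : 0 <= K%:R :> R := ler0n _ _.
    have lnle : ln (K%:R + 1) <= ln M%:R :> R.
      by rewrite ler_ln ?posrE ?EM ?natrD ?natrM; lra.
    rewrite EM; apply: le_trans (X_odd_dist R K) _; rewrite -EM.
    have -> : 8 * K%:R + 4 = 4 * M%:R :> R by rewrite EM natrD natrM; ring.
    by rewrite ler_pM2r ?invr_gt0; lra.
apply: le_trans half _; move: lnM_le.
rewrite -ss => lnM_le; rewrite ler_pdivrMr; last by rewrite !mulr_gt0 //; lra.
(* It remains to see [16 / 3 + 2 * (s - 1) <= 8 * s], which follows from [s >= 1]. *)
have -> : 2 / s * (4 * (s * s)) = 8 * s by field; lra.
lra.
Qed.

Lemma cvg_X (R : realType) : X R M @[M --> \oo] --> (1 / 4 : R).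
Proof.
apply/cvgrPdist_le => e e0; near=> M.
have M0 : (0 < M)%N by near: M; exact: nbhs_infty_gt.
rewrite distrC; apply: le_trans (X_dist R M0) _.
rewrite ler_pdivrMr ?sqrtr_gt0 ?ltr0n // mulrC -ler_pdivrMr //.
(* The goal [2 / e <= Num.sqrt M] is squared, giving the threshold [(2 / e) ^+ 2 <= M]. *)
have /ltW/ger0_norm <- : 0 < 2 / e by rewrite divr_gt0.
rewrite -sqrtr_sqr ler_sqrt ?ler0n //.
by near: M; exact: nbhs_infty_ger.
Unshelve. all: by end_near. Qed.

Theorem theorem1 (R : realType) :
  (forall K : nat, (0 < K)%N ->
    [/\ X R (2 * K) =
          1 / 4 + 1 / (8 * K%:R) * \sum_(1 <= j < K.+1) 1 / (j%:R - 1 / 2),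
        X R (2 * K + 1) =
          (K%:R + 1) / (4 * K%:R + 2)
          + 1 / (8 * K%:R + 4) * \sum_(1 <= j < K.+2) 1 / (j%:R - 1 / 2),
        `|X R (2 * K) - 1 / 4|
          <= 1 / (3 * K%:R) + ln (K%:R + 1) / (8 * K%:R)
      & `|X R (2 * K + 1) - 1 / 4|
          <= (16 / 3 + ln (K%:R + 1)) / (8 * K%:R + 4)]) /\
  X R M @[M --> \oo] --> (1 / 4 : R) /\
  1 / M%:R * (\sum_(1 <= N < M.+1)
    (1 / N%:R * (\sum_(1 <= n < N.+1)
      (((U n)%:R - 4 * (U (n %/ 2))%:R) / (1 - 4)))))
    @[M --> \oo] --> (- (1 / 12) : R).
Proof.
split=> [K K0|]; last split.
- by split; [exact: X_even|exact: X_odd|exact: X_even_dist|exact: X_odd_dist].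
- exact: cvg_X.
(* The constant factor [1 / (1 - 4)] passes through both averages, so this sequence is
   [X R M / (1 - 4)]. *)
- have -> : - (1 / 12) = 1 / 4 / (1 - 4) :> R by field.
  rewrite (_ : (fun M => _) = (fun M => X R M / (1 - 4))).
    exact: cvgMl (@cvg_X R).
  apply/funext => M; rewrite /X /Defs.cesaro -[RHS]mulrA mulr_suml.
  congr (_ * _); apply: eq_bigr => N _.
  by rewrite /Z /Defs.cesaro -[RHS]mulrA mulr_suml.
Qed.
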